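(* Let $d\ge 1$, let $S\subset\mathbb{Z}^d$ be a fixed set of $n$ winning directions (primitive vectors), and let $m$ be a positive integer. Suppose that for every positive integer $N$, Breaker has a pairing strategy on the board $[N]^d=\{1,\ldots,N\}^d$, i.e. there is a collection of pairwise disjoint two-element subsets of $[N]^d$ such that every winning set contained in $[N]^d$ contains both elements of some pair. Then Breaker also has a pairing strategy on the board $\mathbb{Z}^d$, i.e. there is a collection of pairwise disjoint two-element subsets of $\mathbb{Z}^d$ such that every winning set in $\mathbb{Z}^d$ contains both elements of some pair.
   Context: A vector $(w_1,\ldots,w_d)\in\mathbb{Z}^d$ is primitive if $\gcd(w_1,\ldots,w_d)=1$. A winning set is a set of $m$ consecutive points in one of the directions of $S$, i.e. $\{\vec a+k\vec v:0\le k\le m-1\}$ with $\vec v\in S$; on the board $[N]^d$ the winning sets are those contained in $[N]^d$. A pairing strategy is a matching of points of the board (not necessarily covering all points) such that every winning set contains at least one matched pair. *)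

(* Defs.v *)
From mathcomp Require Import all_boot all_order all_algebra.
From mathcomp Require Import finmap.
From mathcomp Require Import boolp classical_sets.

Set Implicit Arguments.
Unset Strict Implicit.
Unset Printing Implicit Defensive.

Import Order.TTheory GRing.Theory Num.Theory.
Local Open Scope ring_scope.
Local Open Scope classical_set_scope.

Definition primitive_vector (d : nat) (w : 'rV[int]_d) : Prop :=
  \big[gcdz/0]_(i < d) w ord0 i = 1.

Definition consecutive_points (d m : nat) (a v : 'rV[int]_d) : set 'rV[int]_d :=
  [set a + v *+ k | k in [set k : nat | (k < m)%N]].

Definition winning_set (d m : nat) (S : {fset 'rV[int]_d})
    (W : set 'rV[int]_d) : Prop :=
  exists a : 'rV[int]_d, exists2 v : 'rV[int]_d,
    v \in S & W = consecutive_points m a v.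

Definition box (d N : nat) : set 'rV[int]_d :=
  [set x | forall i : 'I_d, 1 <= x ord0 i <= N%:Z].
Arguments box : clear implicits.

(* The board B is infinite in general, so the collection of pairs P is a
   classical set, whereas each pair is a finite set with two elements. *)
Definition pairing_strategy (d m : nat) (S : {fset 'rV[int]_d})
    (B : set 'rV[int]_d) (P : set {fset 'rV[int]_d}) : Prop :=
  [/\ forall p, P p -> #|` p| = 2%N /\ [set` p] `<=` B,
      trivIset P (fun p : {fset 'rV[int]_d} => [set` p])
    & forall W, winning_set m S W -> W `<=` B ->
        exists2 p, P p & [set` p] `<=` W].

Definition has_pairing_strategy (d m : nat) (S : {fset 'rV[int]_d})
    (B : set 'rV[int]_d) : Prop :=
  exists P : set {fset 'rV[int]_d}, pairing_strategy m S B P.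

(* Main.v *)
(** Recentre the boards at the origin, so that they exhaust Z^d, and let U be a
    nonprincipal ultrafilter on the indices N. Keep the pairs that belong to
    the N-th strategy for U-many N. Two such pairs lie in a common strategy,
    hence are equal or disjoint. A winning set W lies in almost all boards, and
    since W has only finitely many subsets, one and the same pair inside W is
    used for U-many N. *)
Require Import Defs.
From mathcomp Require Import all_boot all_order all_algebra.
From mathcomp Require Import finmap.
From mathcomp Require Import boolp classical_sets.
From mathcomp Require Import filter.
From mathcomp Require Import zify.

Set Implicit Arguments.
Unset Strict Implicit.
Unset Printing Implicit Defensive.

Import Order.TTheory GRing.Theory Num.Theory.
Local Open Scope ring_scope.
Local Open Scope classical_set_scope.

(** Induction on [s]: if [A i] is not in [U], its complement is, and intersecting with that
    complement removes [i] from the union. The empty union is not in [U]. *)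
Lemma ultrafilter_exists_mem (T : Type) (I : eqType) (U : set_system T)
    (s : seq I) (A : I -> set T) :
  UltraFilter U -> U [set t | exists2 i, i \in s & A i t] ->
  exists2 i, i \in s & U (A i).
Proof.
move=> UU; elim: s => [|i s IHs] Us.
  by have [t [j]] := filter_ex Us.
have [UAi|UnAi] := in_ultra_setVsetC (A i) UU.
  by exists i; rewrite ?mem_head.
have [|j js UAj] := IHs; last by exists j; rewrite // in_cons js orbT.
apply: filterS (filterI Us UnAi) => t [[j]].
rewrite in_cons => /predU1P[->|js] At nAt; last by exists j.
by case: nAt.
Qed.

Section PairingStrategies.
Variables (d m : nat) (S : {fset 'rV[int]_d}).
Implicit Types (B : set 'rV[int]_d) (a v c : 'rV[int]_d).

Lemma consecutive_points_translate a v c x :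
  consecutive_points m (a + c) v (x + c) <-> consecutive_points m a v x.
Proof.
split=> -[k km]; last by move=> <-; exists k => //; rewrite addrAC.
by rewrite addrAC => /addIr <-; exists k.
Qed.

Definition translate_fset c (p : {fset 'rV[int]_d}) : {fset 'rV[int]_d} :=
  [fset (x + c)%R | x in p]%fset.

(** Translation by [c] is injective and permutes the winning sets, so a strategy pulls back along
    it. This recentres the boxes. *)
Lemma has_pairing_strategy_translate B c :
  has_pairing_strategy m S B ->
  has_pairing_strategy m S [set x | B (x + c)].
Proof.
case=> P [Ppair Ptriv Pwin].
have mem_tr (b x : 'rV[int]_d) (p : {fset 'rV[int]_d}) :
    (x + b \in translate_fset b p) = (x \in p).
  by apply: mem_imfset => y z /addIr.
exists [set p | P (translate_fset c p)]; split.
- move=> p /= /Ppair[card_p pB]; split.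
    by rewrite -card_p card_imfset //; exact: addIr.
  by move=> x xp /=; apply: pB; rewrite /= mem_tr.
- move=> p q /= Pp Pq [x [/= xp xq]].
  have /fsetP pq : (translate_fset c p) = (translate_fset c q).
    by apply: Ptriv => //; exists (x + c); split; rewrite /= mem_tr.
  by apply/fsetP => y; rewrite -(mem_tr c) pq mem_tr.
- move=> _ [a [v vS ->]] WB.
  have [||p Pp pW] := Pwin (consecutive_points m (a + c) v).
  + by exists (a + c), v.
  + move=> x; rewrite -{1}(subrK c x) => /consecutive_points_translate /WB /=.
    by rewrite subrK.
  (* The pair found in the shifted winning set is moved back by [- c]. *)
  exists (translate_fset (- c) p).
    rewrite /=; suff -> : translate_fset c (translate_fset (- c) p) = p by [].
    by apply/fsetP => x; rewrite -{1}(subrK c x) mem_tr mem_tr.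
  move=> x /= /imfsetP[y /= yp ->].
  by apply/(consecutive_points_translate _ _ c); rewrite subrK; exact: pW.
Qed.

Lemma has_pairing_strategy_exhaustion (B : nat -> set 'rV[int]_d) :
  (forall x, \forall N \near \oo, B N x) ->
  (forall N, has_pairing_strategy m S (B N)) ->
  has_pairing_strategy m S setT.
Proof.
move=> Bx /choice[Q Qstrat].
(* [U] refines the filter of cofinite sets of indices, so whatever holds for all large [N] holds on
   a member of [U]. *)
have [U [UU ooU]] := ultraFilterLemma eventually_filter.
exists [set p | U [set N | Q N p]]; split.
- move=> p /= /filter_ex[N QNp]; split=> //.
  by have [/(_ _ QNp)[]] := Qstrat N.
- move=> p q /= Up Uq pq; have [N [QNp QNq]] := filter_ex (filterI Up Uq).
  by have [_ + _] := Qstrat N; exact.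
- move=> _ [a [v vS ->]] _.
  pose W := [fset (a + v *+ k)%R | k in iota 0 m]%fset.
  have WE : [set` W] = consecutive_points m a v.
    apply/seteqP; split=> [x /imfsetP[k /=]|x [k /= km <-]].
      by rewrite mem_iota /= => km ->; exists k.
    by apply/imfsetP; exists k; rewrite //= mem_iota.
  have UW : U [set N | [set` W] `<=` B N].
    apply: ooU; have := filter_bigI (D := W) (f := fun x => [set N | B N x])
      eventually_filter (fun x _ => Bx x).
    by apply: filterS => N BN x; exact: BN.
  (* The pair chosen inside [W] may vary with [N], but it ranges over the finite powerset of [W], so
     [U] singles out one choice. *)
  have [|p pW Up] := ultrafilter_exists_mem (I := {fset 'rV[int]_d})
    (s := fpowerset W) (A := fun p => [set N | Q N p]) UU.
    apply: filterS UW => N WB; have [_ _ Qwin] := Qstrat N.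
    have [||p Qp pW] := Qwin [set` W]; [by exists a, v | by [] |].
    by exists p => //; rewrite fpowersetE; apply/fsubsetP => x; exact: pW.
  exists p => //; rewrite -WE => x.
  by move: pW; rewrite fpowersetE => /fsubsetP/(_ x).
Qed.

End PairingStrategies.

(** The shift by [N.+1] turns the box of side [N.*2.+1] into the cube of points with all coordinates
    between -N and N; it contains [x] once N reaches the l1 norm of [x]. *)
Lemma near_centered_box (d : nat) (x : 'rV[int]_d) :
  \forall N \near \oo, box d N.*2.+1 (x + const_mx N.+1%:Z).
Proof.
exists (\sum_(i < d) `|x ord0 i|)%N => //= N /= xN i; rewrite !mxE.
have bound (y : int) : (`|y| <= N)%N -> 1 <= y + N.+1%:Z <= N.*2.+1%:Z by lia.
by apply/bound/(leq_trans _ xN); rewrite (bigD1 i) //= leq_addr.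
Qed.

Theorem theorem3 (d n m : nat) (S : {fset 'rV[int]_d}) (hd : (0 < d)%N)
    (hn : #|` S|%fset = n)
    (hS : forall v : 'rV[int]_d, v \in S -> primitive_vector v)
    (hm : (0 < m)%N)
    (hbox : forall N : nat, (0 < N)%N -> has_pairing_strategy m S (box d N)) :
  has_pairing_strategy m S [set: 'rV[int]_d]%classic.
Proof.
apply: (has_pairing_strategy_exhaustion (@near_centered_box d)) => N.
(* The side [N.*2.+1] is positive even for N = 0, as [hbox] requires. *)
exact/has_pairing_strategy_translate/hbox.
Qed.
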